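(* Let $\mathcal H$ be an infinite dimensional complex Hilbert space, let $m\geq 1$ be an integer, and let $S,T\in B(\mathcal H)$ be such that $T$ is power bounded and $S$ is left $m$-invertible by $T$, i.e. $\sum_{j=0}^m(-1)^{m-j}\binom{m}{j}T^jS^j=0$. Then the following statements are mutually equivalent. (i) $S$ is power bounded. (ii) There exist a positive invertible operator $P\in B(\mathcal H)$ and an isometry $V\in B(\mathcal H)$ such that $S=P^{-1}VP$. (iii) There exists a positive invertible operator $A\in B(\mathcal H)$ such that the operator $A^{-1}S^*A$ is a power bounded left $m$-inverse of $S$. Furthermore, if any of the statements (i), (ii), (iii) holds, and $S^*$ has SVEP at $0$ (or $S$ has dense range), then $S$ and $T^*$ are, respectively, similar to some unitary operators $U_1$ and $U_2$ such that $U_1=PU_2P^{-1}$ for some invertible operator $P\in B(\mathcal H)$.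
   Context: $B(\mathcal H)$ denotes the algebra of bounded linear operators on $\mathcal H$. An operator $A\in B(\mathcal H)$ is power bounded if there is a scalar $M>0$ with $\sup_{n\in\mathbb N}\|A^n\|<M$. For $S,T\in B(\mathcal H)$ and an integer $m\geq 1$, $T$ is a left $m$-inverse of $S$ (equivalently, $S$ is left $m$-invertible by $T$) if $\sum_{j=0}^m(-1)^{m-j}\binom{m}{j}T^jS^j=0$. An operator $A\in B(\mathcal H)$ has SVEP (the single-valued extension property) at $\lambda_0\in\mathbb C$ if for every open disc $D_{\lambda_0}$ centered at $\lambda_0$ the only analytic function $f:D_{\lambda_0}\to\mathcal H$ satisfying $(A-\lambda I)f(\lambda)=0$ for all $\lambda\in D_{\lambda_0}$ is $f\equiv 0$. Two operators $A,B\in B(\mathcal H)$ are similar if $A=XBX^{-1}$ for some invertible $X\in B(\mathcal H)$. *)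

(* Defs.v *)
From HB Require Import structures.
From mathcomp Require Import all_boot all_order all_algebra.
From mathcomp Require Import all_classical all_reals all_analysis.
From mathcomp Require Import complex ring lra.
Set Implicit Arguments.
Unset Strict Implicit.
Unset Printing Implicit Defensive.
Import Order.TTheory GRing.Theory Num.Theory.
Import numFieldNormedType.Exports.
Local Open Scope classical_set_scope.
Local Open Scope complex_scope.
Local Open Scope ring_scope.

(* The inner product is linear in its first argument; completeness is that of
   the norm, which hdot_norm ties to the inner product. *)
Record hilbertSpace (R : realType) := HilbertSpace {
  hilbert_sort :> completeNormedModType R[i];
  hdot : {dot hilbert_sort for Num.conj};
  hdot_norm : forall x, hdot x x = `|x| ^+ 2 }.

(* B(H): for linear maps, continuity is boundedness, see linear_continuousP. *)
Record bop (R : realType) (H : hilbertSpace R) := BOp {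
  bop_linear :> {linear H -> H};
  bop_continuous : continuous bop_linear }.

Section Riesz.
Variables (R : realType) (H : hilbertSpace R).
Local Notation "''[' u , v ]" := (hdot H u v) : ring_scope.
Implicit Types (x y z : H).

Lemma hdotC x y : '[x, y] = Num.conj '[y, x].
Proof. by rewrite hermC expr0 mul1r. Qed.

Lemma hdot_inj x y : (forall z, '[z, x] = '[z, y]) -> x = y.
Proof.
move=> h; apply/eqP; rewrite -subr_eq0 -(dnorm_eq0 (hdot H)).
by rewrite linearBr /= h subrr.
Qed.

Let N x : R := complex.Re (`|x| ^+ 2).

Let NE x : `|x| ^+ 2 = (N x)%:C.
Proof. by rewrite /N RRe_real // ger0_real // exprn_ge0. Qed.

Let N_ge0 x : 0 <= N x.
Proof. by rewrite -ler0c -NE exprn_ge0. Qed.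

Lemma parallelogram x y :
  `|x - y| ^+ 2 = 2 * `|x| ^+ 2 + 2 * `|y| ^+ 2 - `|x + y| ^+ 2.
Proof.
by rewrite -!hdot_norm dnormB dnormD /=; ring.
Qed.

Lemma hdot_min_ortho x y :
  (forall a : R[i], `|x| ^+ 2 <= `|x + a *: y| ^+ 2) -> '[y, x] = 0.
Proof.
move=> hmin; have [->|y0] := eqVneq y 0; first by rewrite linear0l.
have yy0 : '[y, y] != 0 by rewrite dnorm_eq0.
have := hmin (- ('[x, y] / '[y, y])).
rewrite -!hdot_norm dnormD dnormZ linearZr_LR /= (hdotC y x).
set d := '[x, y]; set s := '[y, y] => h.
have sr : Num.conj s = s by rewrite /s -hdotC.
have : `|d| ^+ 2 / s <= 0.
  rewrite -oppr_ge0; move: h; rewrite -subr_ge0; congr (0 <= _).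
  rewrite !normCK !(rmorphN, rmorphM, fmorphV) /= conjCK !sr.
  by field.
rewrite pmulr_lle0 ?invr_gt0 ?dnorm_gt0 // => d0.
have /eqP : `|d| ^+ 2 = 0 by apply/eqP; rewrite eq_le d0 exprn_ge0.
by rewrite expf_eq0 /= normr_eq0 => /eqP ->; rewrite rmorph0.
Qed.

Variables (f : {linear H -> R[i]^o}) (cf : continuous f).

Let A : set H := [set x | f x = 1].
Let d : R := inf [set N x | x in A].

Let d_le x : A x -> d <= N x.
Proof.
by move=> Ax; apply: ge_inf; [exists 0 => _ [y _ <-]; exact: N_ge0|exists x].
Qed.

Let F : set_system H :=
  [set X | exists2 e : R, 0 < e & forall x, A x -> N x < d + e -> X x].

Let F_filter x0 : A x0 -> ProperFilter F.
Proof.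
move=> Ax0; split.
  move=> [e e0 hX].
  have hi : has_inf [set N x | x in A].
    by split; [exists (N x0), x0|exists 0 => _ [y _ <-]; exact: N_ge0].
  have [_ [x Ax <-] xd] := inf_adherent e0 hi.
  exact: hX xd.
split.
- by exists 1.
- move=> X Y [e e0 hX] [e' e'0 hY]; exists (Num.min e e').
    by rewrite lt_min e0 e'0.
  move=> x Ax; rewrite -ltrBlDl lt_min !ltrBlDl => /andP[h1 h2].
  by split; [exact: hX|exact: hY].
- by move=> X Y XY [e e0 hX]; exists e => // x Ax /(hX x Ax)/XY.
Qed.

Let F_near x y e : A x -> A y -> N x < d + e -> N y < d + e ->
  `|x - y| ^+ 2 < (4 * e)%:C.
Proof.
move=> Ax Ay xe ye.
have Am : A (2^-1 *: (x + y)).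
  rewrite /A /= linearZ linearD /= Ax Ay; apply: mulVf.
  by rewrite (pnatr_eq0 _ 2).
have h4 : N (x + y) = 4 * N (2^-1 *: (x + y)).
  apply: complexI; rewrite rmorphM /= -!NE normrZ exprMn.
  rewrite ger0_norm ?invr_ge0 ?ler0n // rmorph_nat; by field.
have := d_le Am; rewrite parallelogram !NE => hd.
rewrite -[2 : R[i]](rmorph_nat (real_complex R)).
rewrite -!rmorphM -rmorphD -rmorphB /= ltcR h4; lra.
Qed.

Let F_cauchy x0 : A x0 -> cauchy F.
Proof.
move=> Ax0; have FF := F_filter Ax0; apply/cauchy_ballP => e e0.
have eC : e = (complex.Re e)%:C by rewrite RRe_real // gtr0_real.
have r0 : 0 < complex.Re e by rewrite -ltcR -eC.
pose X := [set x | A x /\ N x < d + (complex.Re e) ^+ 2 / 4].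
exists (X, X) => /=.
  have FX : F X.
    exists ((complex.Re e) ^+ 2 / 4) => //.
    by rewrite divr_gt0 // exprn_gt0.
  by split.
move=> [x y] /= [[Ax xe] [Ay ye]].
rewrite -ball_normE /ball_ /=.
have := F_near Ax Ay xe ye; rewrite mulrC divfK ?pnatr_eq0 //.
rewrite rmorphXn /= -eC ltr_pXn2r ?nnegrE //; exact: ltW.
Qed.

Theorem riesz : exists y, forall x, f x = '[x, y].
Proof.
have [[x0 fx0]|/forallNP f0] := pselect (exists x, f x != 0); last first.
  by exists 0 => x; rewrite linear0r; have /negP := f0 x; rewrite negbK => /eqP.
have Ax : A ((f x0)^-1 *: x0) by rewrite /A /= linearZ /=; exact: mulVf.
have FF := F_filter Ax.
have /cvg_ex[p Fp] : cvg F by apply: cauchy_cvg; exact: F_cauchy Ax.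
have Ap : f p = 1.
  have h1 : f @ F --> f p by apply: cvg_comp Fp _; exact: cf.
  have h2 : f @ F --> (1 : R[i]^o).
    apply: cvg_near_cst; exists 1 => // x /= -> _; exact: eqxx.
  exact: cvg_unique h1 h2.
have pmin x : A x -> `|p| ^+ 2 <= `|x| ^+ 2.
  move=> Ay; rewrite !NE lecR leNgt; apply/negP => xp.
  have ab : `|x| < `|p| by rewrite -(@ltr_pXn2r _ 2) ?nnegrE // !NE ltcR.
  have [ac cb] := midf_lt ab; set c := (_ / 2) in ac cb.
  have c0 : 0 <= c by rewrite (le_trans _ (ltW ac)).
  have ace : 0 < c ^+ 2 - `|x| ^+ 2 by rewrite subr_gt0 ltr_pXn2r ?nnegrE.
  have eE := RRe_real (gtr0_real ace); set e := complex.Re _ in eE.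
  have e0 : 0 < e by rewrite -ltcR eE.
  have pF : F [set w | `|p - w| < `|p| - c].
    apply: Fp; apply/nbhs_ballP; exists (`|p| - c); first by rewrite /= subr_gt0.
    by rewrite -ball_normE.
  near F => w.
  have Nw : N w < d + e by near: w; exists e.
  have wc : `|w| < c.
    rewrite -(@ltr_pXn2r _ 2) ?nnegrE //.
    rewrite NE (@lt_le_trans _ _ (N x + e)%:C) //.
      by rewrite ltcR (lt_le_trans Nw) // lerD2r d_le.
    by rewrite rmorphD /= eE -NE addrC subrK.
  have pw : `|p - w| < `|p| - c.
    by near: w; exact: pF.
  have := ler_normD (p - w) w; rewrite subrK => /le_lt_trans/(_ (ltrD pw wc)).
  by rewrite subrK ltxx.
have ortho x : f x = 0 -> '[x, p] = 0.
  move=> fx; apply: hdot_min_ortho => a; apply: pmin.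
  by rewrite /A /= linearD linearZ /= fx Ap scaler0 addr0.
have p0 : '[p, p] != 0.
  rewrite dnorm_eq0; apply/eqP => p0; move/eqP: Ap.
  by rewrite p0 linear0 eq_sym oner_eq0.
exists ('[p, p]^-1 *: p) => x.
have /ortho : f (x - f x *: p) = 0.
  by rewrite linearB linearZ /= Ap [_ *: _]mulr1 subrr.
rewrite linearBl linearZl_LR /= => /eqP; rewrite subr_eq0 => /eqP e.
rewrite linearZr_LR /= e fmorphV /= -hdotC.
by rewrite mulrC mulfK.
Unshelve. all: by end_near. Qed.
End Riesz.

Lemma linear_continuousP (R : realType) (V W : normedModType R[i])
    (f : {linear V -> W}) :
  continuous f <-> exists2 M : R[i], 0 < M & forall x, `|f x| <= M * `|x|.
Proof.
rewrite -linear_bounded_continuous linear_boundedP; split.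
  by move=> /pinfty_ex_gt0[M M0 h]; exists M.
move=> [M M0 h]; exists M; split; first exact: gtr0_real.
by move=> r Mr x; rewrite (le_trans (h x)) // ler_wpM2r // ltW.
Qed.

Section Adjoint.
Variables (R : realType) (H : hilbertSpace R).
Local Notation "''[' u , v ]" := (hdot H u v) : ring_scope.
Implicit Types (x y z : H) (S : bop H).

Lemma cauchy_schwarz x y : `|'[x, y]| <= `|x| * `|y|.
Proof.
have [->|y0] := eqVneq y 0; first by rewrite linear0r !normr0 mulr0.
have yy0 : 0 < '[y, y] by rewrite dnorm_gt0.
rewrite -(@ler_pXn2r _ 2) ?nnegrE ?mulr_ge0 // exprMn -!hdot_norm.
rewrite -ler_pdivrMr //; set a := '[x, y] / '[y, y].
have o : '[x - a *: y, a *: y] = 0.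
  rewrite linearBl linearZl_LR /= !linearZr_LR /= /a.
  by rewrite divfK ?gt_eqF // subrr.
have -> : '[x, x] = '[x - a *: y, x - a *: y] + '[a *: y, a *: y].
  by rewrite -hnormDd ?o // subrK.
rewrite [X in _ + X]dnormZ /a normrM exprMn normfV (ger0_norm (ltW yy0)).
rewrite -[leLHS]add0r lerD ?dnorm_ge0 //.
by rewrite le_eqVlt; apply/orP; left; apply/eqP; field; rewrite gt_eqF.
Qed.

Let ladj S y x : R[i]^o := '[S x, y].

Let ladj_linear S y : linear (ladj S y).
Proof.
by move=> a u v; rewrite /ladj linearP linearDl linearZl_LR.
Qed.

Lemma adjoint_exists S :
  exists S' : bop H, forall x y, '[S x, y] = '[x, S' y].
Proof.
have [M M0 SM] : exists2 M : R[i], 0 < M & forall x, `|S x| <= M * `|x|.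
  by apply/linear_continuousP; exact: (@bop_continuous _ _ S).
have rep y : exists z, forall x, '[S x, y] = '[x, z].
  pose f : {linear H -> R[i]^o} :=
    HB.pack (ladj S y) (GRing.isLinear.Build _ _ _ _ _ (ladj_linear S y)).
  apply: (@riesz _ _ f); apply/linear_continuousP; exists (M * (1 + `|y|)).
    by rewrite mulr_gt0 // ltr_pwDl.
  move=> x; apply: le_trans (cauchy_schwarz _ _) _.
  rewrite mulrAC ler_pM // lerDr //.
have [g gP] := choice rep.
have g_linear : linear g.
  move=> a u v; apply: hdot_inj => z; rewrite -gP.
  by rewrite !linearD !linearZ_LR /= !gP.
pose G : {linear H -> H} := HB.pack g (GRing.isLinear.Build _ _ _ _ _ g_linear).
suff cG : continuous G by exists (BOp cG) => x y; exact: gP.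
apply/linear_continuousP; exists M => // y /=.
have [->|gy0] := eqVneq (g y) 0; first by rewrite normr0 mulr_ge0 // ltW.
rewrite -(@ler_pM2l _ `|g y|) ?normr_gt0 // -expr2 -hdot_norm -gP.
rewrite -[leLHS]ger0_norm ?gP ?dnorm_ge0 // -gP.
by rewrite (le_trans (cauchy_schwarz _ _)) // mulrA ler_wpM2r // mulrC.
Qed.

Definition adjoint S : bop H := projT1 (cid (adjoint_exists S)).

Lemma adjointP S x y : '[S x, y] = '[x, adjoint S y].
Proof. exact: (projT2 (cid (adjoint_exists S))). Qed.

Lemma adjoint_unique S S' :
  (forall x y, '[S x, y] = '[x, S' y]) -> S' =1 adjoint S.
Proof. by move=> h y; apply: hdot_inj => x; rewrite -h adjointP. Qed.

End Adjoint.

Section Operators.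
Variables (R : realType) (H : hilbertSpace R).
Implicit Types (A B S T U V X Y : bop H) (f g : H -> H) (m n : nat).

Definition infinite_dimensional : Prop :=
  forall n (v : 'I_n -> H), exists x : H,
    forall c : 'I_n -> R[i], x <> \sum_(i < n) c i *: v i.

(* The library norm is R[i]-valued (real and nonnegative), hence the real part.
   Suprema are taken in the extended reals, since sup is 0 on unbounded sets. *)
Definition opnorm f : \bar R :=
  ereal_sup [set (complex.Re `|f x|)%:E | x in [set x : H | `|x| <= 1]].

Definition power_bounded f : Prop :=
  exists2 M : R, 0 < M &
    (ereal_sup [set opnorm (iter n f) | n in [set: nat]] < M%:E)%E.

(* g is a left m-inverse of f *)
Definition left_minverse m g f : Prop :=
  forall x : H,
    \sum_(j < m.+1)
      ((-1) ^+ (m - j) * 'C(m, j)%:R) *: iter j g (iter j f x) = 0.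

Definition mutually_inverse X Y : Prop := cancel X Y /\ cancel Y X.

(* On a complex space this already forces A to be self-adjoint. *)
Definition positive_op A : Prop := forall x : H, 0 <= hdot H (A x) x.

Definition isometric_op V : Prop := forall x : H, `|V x| = `|x|.

Definition unitary_op U : Prop :=
  cancel U (adjoint U) /\ cancel (adjoint U) U.

Definition similar_ops A B : Prop :=
  exists X Y, mutually_inverse X Y /\ A =1 X \o B \o Y.

(* analytic = complex differentiable at every point (for open D); R[i]^o is
   R[i] as a one-dimensional normed space over itself *)
Definition analytic_on (D : set R[i]^o) (f : R[i]^o -> H) : Prop :=
  forall z, D z -> derivable f z 1.

Definition has_SVEP_at A (z0 : R[i]) : Prop :=
  forall (r : R) (f : R[i]^o -> H), 0 < r ->
    let D : set R[i]^o := ball (z0 : R[i]^o) r%:C in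
    analytic_on D f ->
    (forall z, D z -> A (f z) - z *: f z = 0) ->
    forall z, D z -> f z = 0.

End Operators.

(* Main.v *)
Require Import Defs.
From HB Require Import structures.
From mathcomp Require Import all_boot all_order all_algebra.
From mathcomp Require Import all_classical all_reals all_analysis.
From mathcomp Require Import complex.
From mathcomp Require Import ring lra.
Set Implicit Arguments.
Unset Strict Implicit.
Unset Printing Implicit Defensive.
Import Order.TTheory GRing.Theory Num.Theory.
Import numFieldNormedType.Exports.
Local Open Scope classical_set_scope.
Local Open Scope complex_scope.
Local Open Scope ring_scope.

(** The proof turns on two facts about a power bounded S. Adjoints are written
    S' and T'.

    If T is a power bounded left m-inverse of S, the sequence T^n S^n x has
    vanishing m-th differences, so it is a polynomial in n; it is bounded, hence
    constant, and T S = 1 ([powers_bounded_left_inverse]). In particular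
    |S^n x| lies between two fixed positive multiples of |x|.

    Averaging the forms <S^n x, S^n y> with a Banach limit
    ([banach_limit_exists]) then gives an equivalent inner product <x, B y>
    that S preserves ([invariant_form]). Its positive square root P
    ([positive_sqrt]) makes V = P S P^-1 an isometry, which is (ii). The
    invariance reads S' B S = B with B = P^2, so B^-1 S' B is a left inverse of
    S, similar to the power bounded operator S', which is (iii). Conversely
    each of (ii) and (iii) exhibits S or S' as similar to a power bounded
    operator, and an operator is power bounded exactly when its adjoint is.

    For the last part, both alternatives give ker S' = 0. Under SVEP at 0 this
    is because S' T' = 1: a vector e in ker S' would extend to the analytic
    family (1 - l T')^-1 e of eigenvectors of S' ([svep_kernel]). As S' B is
    injective and annihilates y - S B^-1 S' B y for every y, the operator S is
    onto, with inverse T = B^-1 S' B. Hence U = P S P^-1 is unitary, S = P^-1 U P, and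
    T' = P U P^-1, so that a single unitary operator serves for both. *)

(** * Real-valued norms and geometric convergence *)

Section RealNorm.
Variables (R : realType) (H : hilbertSpace R).
Local Notation "''[' u , v ]" := (hdot H u v) : ring_scope.
Implicit Types (x y z u v w : H) (a b : R[i]).

(** The norm takes values in R[i], whose order is only partial; its real part
    lives in an ordered field with total order, where inequalities can be
    decided linearly. *)
Definition rnorm x : R := complex.Re `|x|.

Lemma normE x : `|x| = (rnorm x)%:C.
Proof. by rewrite /rnorm RRe_real // normr_real. Qed.

Lemma rnorm_le x (M : R) : (rnorm x <= M) = (`|x| <= M%:C).
Proof. by rewrite normE lecR. Qed.

Lemma rnorm_ge0 x : 0 <= rnorm x.
Proof. by rewrite -lecR -normE normr_ge0. Qed.

Lemma rnorm0 : rnorm (0 : H) = 0.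
Proof. by rewrite /rnorm normr0. Qed.

Lemma rnorm_eq0 x : rnorm x = 0 -> x = 0.
Proof. by move=> x0; apply/eqP; rewrite -normr_eq0 normE x0. Qed.

Lemma rnormD x y : rnorm (x + y) <= rnorm x + rnorm y.
Proof. by rewrite -lecR rmorphD /= -!normE ler_normD. Qed.

Lemma rnormN x : rnorm (- x) = rnorm x.
Proof. by rewrite /rnorm normrN. Qed.

Lemma rnormB x y : rnorm (x - y) <= rnorm x + rnorm y.
Proof. by rewrite -(rnormN y) rnormD. Qed.

Lemma rnormBC x y : rnorm (x - y) = rnorm (y - x).
Proof. by rewrite -rnormN opprB. Qed.

Lemma rnormZ a x : rnorm (a *: x) = complex.Re `|a| * rnorm x.
Proof.
apply: complexI; rewrite -normE normrZ normE -{1}[`|a|]RRe_real ?normr_real //.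
by rewrite -rmorphM.
Qed.

Lemma rnormZr (r : R) x : rnorm (r%:C *: x) = `|r| * rnorm x.
Proof. by rewrite rnormZ normc_def /= expr0n addr0 sqrtr_sqr. Qed.

Lemma rnorm_tri y x z : rnorm (x - z) <= rnorm (x - y) + rnorm (y - z).
Proof. by rewrite (le_trans _ (rnormD _ _)) // addrA subrK. Qed.

Lemma hdotDl x y z : '[x + y, z] = '[x, z] + '[y, z].
Proof. exact: linearDl. Qed.

Lemma hdotDr x y z : '[x, y + z] = '[x, y] + '[x, z].
Proof. exact: linearDr. Qed.

Lemma hdotBl x y z : '[x - y, z] = '[x, z] - '[y, z].
Proof. exact: linearBl. Qed.

Lemma hdotBr x y z : '[x, y - z] = '[x, y] - '[x, z].
Proof. exact: linearBr. Qed.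

Lemma hdotZl a x y : '[a *: x, y] = a * '[x, y].
Proof. exact: linearZl_LR. Qed.

Lemma hdotZr (r : R) x y : '[x, r%:C *: y] = r%:C * '[x, y].
Proof. by rewrite linearZr_LR; congr (_ * _); exact: conjc_real. Qed.

Lemma Re_realM (r : R) a : complex.Re (r%:C * a) = r * complex.Re a.
Proof. by case: a => p q /=; rewrite mul0r subr0. Qed.

Lemma Re_B a b : complex.Re (a - b) = complex.Re a - complex.Re b.
Proof. by case: a b => [? ?] []. Qed.

Lemma hdotxx x : '[x, x] = (rnorm x ^+ 2)%:C.
Proof. by rewrite hdot_norm normE rmorphXn. Qed.

Lemma Re_hdotxx x : complex.Re '[x, x] = rnorm x ^+ 2.
Proof. by rewrite hdotxx. Qed.

Lemma hdot_CS x y : complex.Re `|'[x, y]| <= rnorm x * rnorm y.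
Proof.
by rewrite -lecR RRe_real ?normr_real // rmorphM /= -!normE; exact: cauchy_schwarz.
Qed.

Lemma Re_hdot_CS x y : `|complex.Re '[x, y]| <= rnorm x * rnorm y.
Proof.
apply: le_trans _ (hdot_CS x y).
by rewrite -lecR RRe_real ?normr_real ?normc_ge_Re.
Qed.

Lemma Im_hdot_CS x y : `|complex.Im '[x, y]| <= rnorm x * rnorm y.
Proof.
apply: le_trans _ (hdot_CS x y).
rewrite normc_def /= -sqrtr_sqr ler_wsqrtr // lerDr sqr_ge0 //.
Qed.

Lemma hdot_re x y : complex.Re '[x, y] = complex.Re '[y, x].
Proof. by rewrite hdotC; case: (hdot _ y x). Qed.

Lemma hdot_im x y : complex.Im '[x, y] = - complex.Im '[y, x].
Proof. by rewrite hdotC; case: (hdot _ y x). Qed.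

Definition bounded_by (M : R) (f : H -> H) := forall x, rnorm (f x) <= M * rnorm x.

Lemma bop_bounded (A : bop H) : exists2 M, 0 < M & bounded_by M A.
Proof.
have /linear_continuousP[M M0 AM] := @bop_continuous _ _ A.
have EM : M = (complex.Re M)%:C by rewrite RRe_real ?gtr0_real.
exists (complex.Re M); first by rewrite -ltcR -EM.
by move=> x; rewrite rnorm_le rmorphM /= -normE -EM.
Qed.

Lemma bop_of (f : H -> H) (M : R) : linear f -> bounded_by M f ->
  exists A : bop H, A =1 f.
Proof.
move=> lf bf.
pose F : {linear H -> H} := HB.pack f (GRing.isLinear.Build _ _ _ _ _ lf).
suff cF : continuous F by exists (BOp cF).
apply/linear_continuousP; exists (1 + `|M|)%:C.
  by rewrite ltcR ltr_pwDl.
move=> x; rewrite -[X in `|X|]/(f x) !normE -rmorphM lecR (le_trans (bf x)) //.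
by rewrite ler_wpM2r ?rnorm_ge0 // (le_trans (ler_norm _)) // lerDr.
Qed.

Lemma bounded_by_comp (M N : R) f g : 0 <= M -> bounded_by M f -> bounded_by N g ->
  bounded_by (M * N) (f \o g).
Proof.
by move=> M0 bf bg x; rewrite (le_trans (bf _)) // -mulrA ler_wpM2l.
Qed.

Definition bcomp (A B : bop H) : bop H :=
  @BOp _ _ (bop_linear A \o bop_linear B)
    (fun x => continuous_comp (@bop_continuous _ _ B x) (@bop_continuous _ _ A (B x))).

(** From |g y|^2 = <f (g y), y> <= M |g y| |y|. *)
Lemma bounded_by_adj (M : R) (f g : H -> H) : 
  (forall x y, '[f x, y] = '[x, g y]) -> bounded_by M f -> bounded_by M g.
Proof.
move=> fg bf y; have := Re_hdot_CS (f (g y)) y; rewrite fg Re_hdotxx.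
rewrite ger0_norm ?sqr_ge0 // => /le_trans h.
have [->|gy0] := eqVneq (rnorm (g y)) 0.
  have [->|y0] := eqVneq y 0; first by rewrite rnorm0 mulr0.
  rewrite mulr_ge0 ?rnorm_ge0 //; have := le_trans (rnorm_ge0 _) (bf y).
  rewrite pmulr_lge0 // lt_neqAle rnorm_ge0 andbT eq_sym.
  by apply: contra y0 => /eqP/rnorm_eq0 ->.
rewrite -(@ler_pM2l _ (rnorm (g y))); last by rewrite lt_neqAle eq_sym gy0 rnorm_ge0.
rewrite -expr2 h // mulrCA mulrA ler_wpM2r ?rnorm_ge0 //; exact: bf.
Qed.

Lemma geometric_le0 (q K r : R) : 0 <= q < 1 -> (forall n, r <= K * q ^+ n) -> r <= 0.
Proof.
move=> /andP[q0 q1] h.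
have c : (fun n => K * q ^+ n) @ \oo --> (0 : R).
  rewrite -(mulr0 K); apply: cvgMr; apply: cvg_expr; by rewrite ger0_norm.
rewrite -(cvg_lim _ c) //; apply: limr_ge; first by apply/cvg_ex; exists 0.
by near=> n; exact: h.
Unshelve. all: by end_near. Qed.

Lemma geometric_eq (q K : R) x y : 0 <= q < 1 ->
  (forall n, rnorm (x - y) <= K * q ^+ n) -> x = y.
Proof.
move=> q01 /(geometric_le0 q01) h; apply/eqP; rewrite -subr_eq0; apply/eqP.
by apply: rnorm_eq0; apply/eqP; rewrite eq_le h rnorm_ge0.
Qed.

(** A sequence with geometrically decaying increments is Cauchy. The explicit
    rate lets identities be transferred to the limit by comparing errors,
    through [geometric_eq], rather than by continuity arguments. *)
Lemma geometric_cvg (q K : R) (u : nat -> H) : 0 <= q < 1 ->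
  (forall n, rnorm (u n.+1 - u n) <= K * q ^+ n) ->
  exists l, forall n, rnorm (l - u n) <= K / (1 - q) * q ^+ n.
Proof.
move=> q01 hu; have /andP[q0 q1] := q01; have q1' : 0 < 1 - q by lra.
have K0 : 0 <= K by have := le_trans (rnorm_ge0 _) (hu 0%N); rewrite expr0 mulr1.
have hnk n k : rnorm (u (n + k)%N - u n) <= K / (1 - q) * (q ^+ n - q ^+ (n + k)).
  elim: k => [|k IH]; first by rewrite addn0 !subrr rnorm0 mulr0.
  rewrite addnS (le_trans (rnorm_tri (u (n + k)%N) _ _)) //.
  apply: le_trans (lerD (hu _) IH) _.
  rewrite le_eqVlt; apply/orP; left; apply/eqP; rewrite exprS; field.
  by rewrite gt_eqF.
have hnk' n k : rnorm (u (n + k)%N - u n) <= K / (1 - q) * q ^+ n.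
  rewrite (le_trans (hnk n k)) // ler_wpM2l //; first exact: divr_ge0 K0 (ltW q1').
  by rewrite lerBlDr lerDl exprn_ge0.
have cq : (fun n => K / (1 - q) * q ^+ n) @ \oo --> (0 : R).
  by rewrite -(mulr0 (K / (1 - q))); apply: cvgMr; apply: cvg_expr; rewrite ger0_norm.
have : cvg (u @ \oo).
  apply: cauchy_cvg; apply: cauchy_exP => e e0.
  have eC : e = (complex.Re e)%:C by rewrite RRe_real // gtr0_real.
  have r0 : 0 < complex.Re e by rewrite -ltcR -eC.
  have [N _ hN] := cvgr0_norm_lt _ cq _ r0.
  exists (u N); exists N => // n /= Nn; rewrite -ball_normE /= eC normE ltcR.
  rewrite rnormBC -(subnKC Nn) (le_lt_trans (hnk' _ _)) //.
  exact: (le_lt_trans (ler_norm _) (hN _ (leqnn N))).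
move=> /cvg_ex[l ul]; exists l => n.
rewrite leNgt; apply/negP => lt.
set e := rnorm (l - u n) - K / (1 - q) * q ^+ n.
have e0 : 0 < e by rewrite subr_gt0.
have /(cvgrPdist_lt _) := ul.
move=> /(_ e%:C); rewrite ltcR => /(_ e0)[N _ hN].
have := hN (n + N)%N; rewrite /= leq_addl => /(_ isT); rewrite normE ltcR.
move=> h; have := rnorm_tri (u (n + N)%N) l (u n).
have := hnk' n N; rewrite /e in h *; lra.
Qed.

End RealNorm.
Arguments bounded_by {R H}.
Arguments rnorm {R H}.
Arguments bcomp {R H}.

(** * Banach limits *)

Section BanachLimit.
Variable R : realType.
Implicit Types (u v : nat -> R).

Definition bounded_seq u := exists K, forall n, `|u n| <= K.

(** Averaging before passing to a limit makes the limit shift invariant. *)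
Definition cesaro_mean u (n : nat) : R := n.+1%:R^-1 * \sum_(k < n.+1) u k.

Lemma cesaro_mean_le u K n : (forall k, u k <= K) -> cesaro_mean u n <= K.
Proof.
move=> h; rewrite /cesaro_mean ler_pdivrMl ?ltr0n //.
have -> : n.+1%:R * K = \sum_(k < n.+1) K by rewrite sumr_const card_ord mulr_natl.
exact: ler_sum.
Qed.

Lemma cesaro_meanD u v n :
  cesaro_mean (u \+ v) n = cesaro_mean u n + cesaro_mean v n.
Proof. by rewrite /cesaro_mean big_split /= mulrDr. Qed.

Lemma cesaro_meanZ c u n :
  cesaro_mean (fun k => c * u k) n = c * cesaro_mean u n.
Proof. by rewrite /cesaro_mean -mulr_sumr mulrCA. Qed.

Lemma cesaro_mean_norm u K n : (forall k, `|u k| <= K) -> `|cesaro_mean u n| <= K.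
Proof.
move=> h; rewrite ler_norml cesaro_mean_le ?andbT; last first.
  by move=> k; exact: le_trans (ler_norm _) (h k).
rewrite lerNl -mulN1r -cesaro_meanZ cesaro_mean_le // => k.
by rewrite mulN1r; have := h k; rewrite ler_norml => /andP[]; rewrite lerNl.
Qed.

Lemma ultra_fmap (T T' : Type) (f : T -> T') (F : set_system T) :
  UltraFilter F -> UltraFilter (f @ F).
Proof.
move=> UF; split; first exact: fmap_proper_filter.
move=> G GF sFG; rewrite predeqE => A; split; last exact: sFG.
move=> GA; have [//|FnA] := in_ultra_setVsetC (f @^-1` A) UF.
have /sFG GnA : (f @ F) (~` A) by [].
by have /filter_ex [? []] : G (A `&` (~` A)) by exact: filterI.
Qed.

(** The limit of the Cesaro means along an ultrafilter finer than the filter of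
    cofinite sets. It exists because bounded sequences live in a compact
    segment, and it is shift invariant because the Cesaro means of a sequence
    and of its shift differ by a boundary term of order 1 / n. *)
Lemma banach_limit_exists : exists L : (nat -> R) -> R,
  [/\ forall u v, bounded_seq u -> bounded_seq v -> L (u \+ v) = L u + L v,
      forall c u, bounded_seq u -> L (fun k => c * u k) = c * L u,
      forall u K, bounded_seq u -> (forall k, u k <= K) -> L u <= K
    & forall u, bounded_seq u -> L (fun k => u k.+1) = L u].
Proof.
have [U [UU Uoo]] : exists U : set_system nat, UltraFilter U /\ \oo `<=` U.
  exact: ultraFilterLemma.
have cvU u : bounded_seq u -> exists l, cesaro_mean u @ U --> (l : R).
  move=> [K uK].
  have UF : UltraFilter (cesaro_mean u @ U).
    exact: ultra_fmap.
  have := @segment_compact R (- K) K; rewrite compact_ultra => /(_ _ UF).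
  case.
    apply: (Uoo); exists 0%N => // n _ /=; rewrite in_itv /= -ler_norml.
    exact: cesaro_mean_norm.
  by move=> l [_ ul]; exists l.
pose L u := lim (cesaro_mean u @ U).
have LP u : bounded_seq u -> cesaro_mean u @ U --> L u.
  by move=> /cvU ?; apply/cvg_ex.
have LE u l : cesaro_mean u @ U --> l -> L u = l by exact: cvg_lim.
exists L; split=> [u v bu bv|c u bu|u K bu uK|u bu].
- apply: LE; have -> : cesaro_mean (u \+ v) = cesaro_mean u \+ cesaro_mean v.
    by apply/funext => n; exact: cesaro_meanD.
  by apply: cvgD; exact: LP.
- apply: LE; have -> : cesaro_mean (fun k => c * u k) = (fun n => c * cesaro_mean u n).
    by apply/funext => n; exact: cesaro_meanZ.
  by apply: cvgMr; exact: LP.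
- have c := LP _ bu; apply: limr_le; first by apply/cvg_ex; exists (L u).
  by apply: nearW => n; exact: cesaro_mean_le.
- apply: LE.
  have E : cesaro_mean (fun k => u k.+1) =
      (fun n => cesaro_mean u n + n.+1%:R^-1 * (u n.+1 - u 0%N)).
    apply/funext => n; rewrite /cesaro_mean -mulrDr; congr (_ * _).
    rewrite -(big_mkord xpredT u) -(big_mkord xpredT (fun k => u k.+1)).
    by rewrite -telescope_sumr // -big_split /=; apply: eq_bigr => k _; rewrite addrC subrK.
  rewrite E -[X in _ --> X]addr0; apply: cvgD; first exact: LP.
  have [K uK] := bu.
  apply: cvg_trans; first exact: (cvg_app _ Uoo).
  apply: (@squeeze_cvgr _ _ _ _ (fun n => - (n.+1%:R^-1 * (K + K)))
     (fun n => n.+1%:R^-1 * (K + K))).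
  + apply: nearW => n; rewrite -ler_norml normrM ger0_norm ?invr_ge0 //.
    by rewrite ler_wpM2l ?invr_ge0 // (le_trans (ler_normB _ _)) // lerD.
  + rewrite -oppr0; apply: cvgN; rewrite -(mul0r (K + K)); apply: cvgMl.
    exact: cvg_harmonic.
  + rewrite -(mul0r (K + K)); apply: cvgMl; exact: cvg_harmonic.
Qed.

End BanachLimit.

(** * Neumann series and square roots of positive operators *)

Section SquareRoot.
Variables (R : realType) (H : hilbertSpace R).
Local Notation "''[' u , v ]" := (hdot H u v) : ring_scope.
Implicit Types (x y z : H).

(** The equation x = y + Y x is solved by iterating a strict contraction;
    the bound on the inverse comes from (1 - q) |x| <= |x - Y x|. *)
Lemma neumann (q : R) (Y : {linear H -> H}) : 0 <= q < 1 -> bounded_by q Y ->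
  exists Z : bop H, [/\ forall x, Z x - Y (Z x) = x,
    forall x, Z (x - Y x) = x & bounded_by (1 - q)^-1 Z].
Proof.
move=> q01 bY; have /andP[q0 q1] := q01; have q1' : 0 < 1 - q by lra.
have low x : (1 - q) * rnorm x <= rnorm (x - Y x).
  have := rnormD (x - Y x) (Y x); rewrite subrK; have := bY x; lra.
have inj x y : x - Y x = y - Y y -> x = y.
  move=> e; have := low (x - y).
  have -> : x - y - Y (x - y) = 0.
    by rewrite linearB opprD opprK addrACA e addrACA subrr addNr addr0.
  rewrite rnorm0 pmulr_rle0 // => h; apply/eqP; rewrite -subr_eq0; apply/eqP.
  by apply: rnorm_eq0; apply/eqP; rewrite eq_le h rnorm_ge0.
have sur y : exists x, x - Y x = y.
  pose u n := iter n (fun x => y + Y x) 0.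
  have uS n : u n.+1 = y + Y (u n) by [].
  have hu n : rnorm (u n.+1 - u n) <= rnorm y * q ^+ n.
    elim: n => [|n IH].
      by rewrite expr0 mulr1 uS /= linear0 addr0 subr0.
    rewrite uS [in X in rnorm (_ - X)]uS opprD addrACA subrr add0r -linearB.
    by rewrite (le_trans (bY _)) // exprS mulrCA ler_wpM2l.
  have [l lP] := geometric_cvg q01 hu; exists l.
  apply: (@geometric_eq _ _ q (rnorm y / (1 - q) * (2 * q))) => // n.
  have -> : l - Y l - y = (l - u n.+1) + Y (u n - l).
    by rewrite uS linearB opprD (addrA l) subrKA addrAC.
  apply: le_trans (rnormD _ _) _.
  have := lP n.+1; have := bY (u n - l); rewrite rnormBC.
  have := ler_wpM2l q0 (lP n); rewrite exprS rnormBC; lra.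
have [Z ZP] := choice sur.
have [Zb ZE] : exists A : bop H, A =1 Z.
  apply: (@bop_of _ _ Z (1 - q)^-1).
    move=> a u v; apply: inj; rewrite ZP linearP -/(Y _) /=.
    rewrite opprD addrACA -scalerBr !ZP //.
  by move=> x; rewrite ler_pdivlMl // (le_trans (low _)) // ZP.
exists Zb; split=> x; rewrite ?ZE //.
- by apply: inj; rewrite ZP.
- by rewrite ler_pdivlMl // (le_trans (low _)) // ZP.
Qed.

Definition selfadjoint (f : H -> H) := forall x y, '[f x, y] = '[x, f y].

Lemma half_add x : (2^-1 : R)%:C *: (x + x) = x.
Proof.
rewrite scalerDr -scalerDl -rmorphD /=.
have -> : (2^-1 + 2^-1 : R) = 1 by field.
by rewrite scale1r.
Qed.

(** If P is to be a square root of 1 - C, then Y = 1 - P solves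
    2 Y = C + Y^2. For |C| <= q < 1 the iteration Y' = (C + Y^2) / 2 stays in
    the ball of radius q, and it contracts there with factor q, because
    U^2 - V^2 = U (U - V) + (U - V) V. *)
Lemma quadratic_fixpoint (q : R) (C : bop H) : 0 <= q < 1 -> bounded_by q C -> selfadjoint C ->
  exists Y : bop H, [/\ bounded_by q Y, selfadjoint Y
    & forall x, Y x + Y x = C x + Y (Y x)].
Proof.
move=> q01 bC sC; have /andP[q0 q1] := q01; have q1' : 0 < 1 - q by lra.
pose hf : R[i] := (2^-1 : R)%:C.
have rhf x : rnorm (hf *: x) = 2^-1 * rnorm x by rewrite rnormZr ger0_norm.
have [stp stpE] : exists s : bop H -> bop H,
    forall Y x, s Y x = hf *: (C x + Y (Y x)).
  have /choice[s sP] : forall Y : bop H, exists Y' : bop H,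
      forall x, Y' x = hf *: (C x + Y (Y x)).
    move=> Y; have [M M0 bY] := bop_bounded Y.
    apply: (@bop_of _ _ _ (2^-1 * (q + M * M))).
      move=> a u v; rewrite !linearP /=  addrACA -scalerDr (scalerDr hf (a *: _)).
      by rewrite !scalerA mulrC.
    move=> x; rewrite rhf -mulrA ler_wpM2l // (le_trans (rnormD _ _)) // mulrDl.
    by rewrite lerD // -mulrA (le_trans (bY _)) // ler_wpM2l // ltW.
  by exists s.
have [z zE] : exists A : bop H, A =1 (fun=> 0).
  apply: (@bop_of _ _ _ 0) => [a u v|x]; first by rewrite scaler0 addr0.
  by rewrite rnorm0 mul0r.
pose Y n := iter n stp z.
have YS n x : Y n.+1 x = hf *: (C x + Y n (Y n x)) by rewrite /Y iterS stpE.
have bY n : bounded_by q (Y n).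
  elim: n => [|n IH] x; first by rewrite zE rnorm0 mulr_ge0 // rnorm_ge0.
  have h1 : rnorm (Y n (Y n x)) <= q * rnorm x.
    rewrite (le_trans (IH _)) // ler_wpM2l // (le_trans (IH _)) //.
    by rewrite ler_piMl ?rnorm_ge0 // ltW.
  rewrite YS rhf; have := rnormD (C x) (Y n (Y n x)); have := bC x; lra.
have sY n : selfadjoint (Y n).
  elim: n => [|n IH] x y; first by rewrite !zE linear0l linear0r.
  by rewrite !YS hdotZl hdotZr hdotDl hdotDr sC !IH.
have dY n x : rnorm (Y n.+1 x - Y n x) <= (rnorm x * q) * q ^+ n.
  elim: n x => [|n IH] x.
    rewrite YS !zE subr0 addr0 rhf expr0 mulr1; have := bC x; have := rnorm_ge0 (C x); lra.
  rewrite YS [Y n.+1 x in X in _ - X]YS -scalerBr rhf opprD addrACA subrr add0r.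
  have h1 := le_trans (bY n.+1 _) (ler_wpM2l q0 (IH x)).
  have h2 : rnorm (Y n.+1 (Y n x) - Y n (Y n x)) <= rnorm x * q * q ^+ n.+1.
    rewrite (le_trans (IH _)) // exprS mulrA ler_wpM2r ?exprn_ge0 //.
    by rewrite ler_wpM2r // [leRHS]mulrC bY.
  have := rnorm_tri (Y n.+1 (Y n x)) (Y n.+1 (Y n.+1 x)) (Y n (Y n x)).
  rewrite -linearB; move: h1 h2; rewrite exprS; set a := rnorm _; set b := rnorm _.
  lra.
have /choice[Z ZP] : forall x, exists l, forall n,
    rnorm (l - Y n x) <= rnorm x * q / (1 - q) * q ^+ n.
  by move=> x; exact: geometric_cvg q01 (fun n => dY n x).
pose c := q / (1 - q).
have c0 : 0 <= c by rewrite divr_ge0 // ltW.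
have ZB x n : rnorm (Z x - Y n x) <= c * rnorm x * q ^+ n.
  by have -> : c * rnorm x * q ^+ n = rnorm x * q / (1 - q) * q ^+ n by rewrite [c * _]mulrC mulrA.
have bZ : bounded_by q Z.
  move=> x; rewrite -subr_le0; apply: (@geometric_le0 R q (c * rnorm x)) => // n.
  have := rnormD (Z x - Y n x) (Y n x); rewrite subrK.
  have := ZB x n; have := bY n x; lra.
have lZ : linear Z.
  move=> a u v.
  apply: (@geometric_eq _ _ q (c * rnorm (a *: u + v) +
      (complex.Re `|a| * (c * rnorm u) + c * rnorm v))) => // n.
  rewrite mulrDl; apply: le_trans (rnorm_tri (Y n (a *: u + v)) _ _) _.
  apply: lerD; first exact: ZB.
  rewrite linearP opprD addrACA -scalerBr mulrDl.
  apply: le_trans (rnormD _ _) (lerD _ _); last by rewrite rnormBC; exact: ZB.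
  rewrite rnormZ -mulrA rnormBC; apply: ler_wpM2l; last exact: ZB.
  by rewrite -ler0c RRe_real ?normr_real ?normr_ge0.
have [Zb ZE] := bop_of lZ bZ.
have sZ : selfadjoint Z.
  move=> x y; apply/eqP; rewrite -subr_eq0 -normr_eq0; apply/eqP.
  apply: le_anti; rewrite normr_ge0 andbT.
  rewrite -[leLHS]RRe_real ?normr_real // lecR.
  apply: (@geometric_le0 R q (2 * c * rnorm x * rnorm y)) => // n.
  have -> : '[Z x, y] - '[x, Z y] = '[Z x - Y n x, y] - '[x, Z y - Y n y].
    by rewrite hdotBl hdotBr sY opprB addrA subrK.
  rewrite -lecR RRe_real ?normr_real // (le_trans (ler_normB _ _)) //.
  rewrite -[`|_|]RRe_real ?normr_real // -[X in _ + X]RRe_real ?normr_real //.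
  rewrite -rmorphD lecR.
  have h1 := le_trans (hdot_CS (Z x - Y n x) y) (ler_wpM2r (rnorm_ge0 y) (ZB x n)).
  have h2 := le_trans (hdot_CS x (Z y - Y n y)) (ler_wpM2l (rnorm_ge0 x) (ZB y n)).
  lra.
exists Zb; split=> [x|x y|x]; rewrite !ZE //.
apply: (@geometric_eq _ _ q (c * q * rnorm x *+ 3 + c * rnorm (Z x))) => // n.
have h0 := ZB x n.+1.
have h1 : rnorm (Z (Z x) - Y n (Z x)) <= c * rnorm (Z x) * q ^+ n by exact: ZB.
have h2 : rnorm (Y n (Z x) - Y n (Y n x)) <= q * (c * rnorm x * q ^+ n).
  by rewrite -linearB (le_trans (bY _ _)) // ler_wpM2l.
have e : Y n.+1 x + Y n.+1 x = C x + Y n (Y n x).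
  by rewrite YS -scalerDr half_add.
have e2 : Z x + Z x - (C x + Z (Z x)) = (Z x - Y n.+1 x) + (Z x - Y n.+1 x)
    - ((Z (Z x) - Y n (Z x)) + (Y n (Z x) - Y n (Y n x))).
  rewrite subrKA addrACA -opprD e -[RHS]addrA -opprD [C x + Y n _ + _]addrACA.
  by rewrite subrr addr0.
rewrite e2 (le_trans (rnormB _ _)) //.
have := rnormD (Z x - Y n.+1 x) (Z x - Y n.+1 x).
have := rnormD (Z (Z x) - Y n (Z x)) (Y n (Z x) - Y n (Y n x)).
move: h0 h1 h2; rewrite exprS; lra.
Qed.

(** The numerical range controls the norm: apply positivity of C to the vector
    x - C x / q to get |C x|^2 <= q <C x, x>. *)
Lemma bounded_selfadjoint (q : R) (C : bop H) : 0 < q -> selfadjoint C ->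
  (forall x, 0 <= complex.Re '[C x, x] <= q * rnorm x ^+ 2) -> bounded_by q C.
Proof.
move=> q0 sC hC x; have q0' := gt_eqF q0.
have /andP[+ _] := hC (x - (q^-1)%:C *: C x).
have /andP[_ +] := hC (C x); have /andP[_ +] := hC x.
have -> : C (x - (q^-1)%:C *: C x) = C x - (q^-1)%:C *: C (C x).
  by rewrite linearB linearZ_LR.
rewrite hdotBl !hdotBr !hdotZr !hdotZl.
rewrite (sC (C x) x) !hdotxx !Re_B !Re_realM /=.
set a := complex.Re '[C x, x]; set b := complex.Re _; set n := rnorm (C x) ^+ 2.
move=> h1 h2 h3.
have : n <= (q * rnorm x) ^+ 2.
  have h4 : q^-1 * (q^-1 * b) <= q^-1 * n by rewrite ler_pM2l ?invr_gt0 // mulrC ler_pdivrMr // mulrC.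
  have h5 : q^-1 * n <= a by lra.
  have h6 : n <= a * q by rewrite -ler_pdivrMr // mulrC.
  rewrite (le_trans h6) // exprMn expr2 -mulrA mulrC ler_pM2l //.
by rewrite ler_pXn2r // nnegrE ?rnorm_ge0 // mulr_ge0 ?rnorm_ge0 // ltW.
Qed.

Lemma Im_selfadjoint (f : H -> H) x : selfadjoint f -> complex.Im '[f x, x] = 0.
Proof. by move=> sf; have := hdot_im (f x) x; rewrite (sf x x); lra. Qed.

Lemma selfadjoint_ge0 (f : H -> H) x : selfadjoint f ->
  0 <= complex.Re '[f x, x] -> 0 <= '[f x, x].
Proof. by move=> sf h; rewrite lecE /= (Im_selfadjoint x sf) eqxx. Qed.

(** After scaling, B = K (1 - C) with 0 <= C <= 1 - d / K, so C is a strict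
    contraction; if Y is the fixed point of [quadratic_fixpoint] then
    (1 - Y)^2 = 1 - C, and 1 - Y is inverted by a Neumann series. *)
Lemma positive_sqrt (B : bop H) (d K : R) : 0 < d < K -> selfadjoint B ->
  (forall x, d * rnorm x ^+ 2 <= complex.Re '[B x, x] <= K * rnorm x ^+ 2) ->
  exists P Pinv : bop H, [/\ mutually_inverse P Pinv, positive_op P, selfadjoint P
    & forall x, P (P x) = B x].
Proof.
move=> /andP[d0 dK] sB hB; have K0 : 0 < K := lt_trans d0 dK.
have [C CE] : exists C : bop H, forall x, C x = x - (K^-1)%:C *: B x.
  have [M M0 bB] := bop_bounded B.
  apply: (@bop_of _ _ _ (1 + K^-1 * M)) => [a u v|x].
    rewrite linearP scalerDr opprD addrACA scalerBr !scalerA.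
    by rewrite [_ * a]mulrC.
  rewrite (le_trans (rnormB _ _)) // rnormZr mulrDl mul1r lerD2l -mulrA.
  by rewrite ger0_norm ?invr_ge0 ?ler_wpM2l ?invr_ge0 // ltW.
have sC : selfadjoint C.
  by move=> x y; rewrite !CE hdotBl hdotBr hdotZl hdotZr sB.
pose q := 1 - d / K.
have dK1 : 0 < d / K < 1 by rewrite divr_gt0 //= ltr_pdivrMr // mul1r.
have q01 : 0 < q < 1 by rewrite /q; lra.
have [q0 q1] := andP q01.
have bC : bounded_by q C.
  apply: bounded_selfadjoint => // x.
  rewrite CE hdotBl hdotZl hdotxx Re_B Re_realM /=.
  have /andP[h1 h2] := hB x; set b := complex.Re _ in h1 h2 *.
  rewrite subr_ge0 [K^-1 * _]mulrC ler_pdivrMr // [_ * K]mulrC h2 /=.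
  rewrite /q mulrBl mul1r lerD2l lerN2 mulrAC ler_pM2r ?invr_gt0 //.
have q01' : 0 <= q < 1 by rewrite ltW.
have [Y [bY sY YE]] := quadratic_fixpoint q01' bC sC.
have [Z [Z1 Z2 bZ]] := neumann q01' bY.
pose s := Num.sqrt K; have s0 : 0 < s by rewrite sqrtr_gt0.
have ss : s * s = K by rewrite -expr2 sqr_sqrtr // ltW.
have [P PE] : exists P : bop H, forall x, P x = s%:C *: (x - Y x).
  apply: (@bop_of _ _ _ (s * (1 + q))) => [a u v|x].
    by rewrite linearP opprD addrACA -scalerBr scalerDr !scalerA mulrC.
  rewrite rnormZr ger0_norm ?(ltW s0) // -mulrA ler_pM2l // (le_trans (rnormB _ _)) //.
  by rewrite mulrDl mul1r lerD2l.
have [Q QE] : exists Q : bop H, forall x, Q x = (s^-1)%:C *: Z x.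
  apply: (@bop_of _ _ _ (s^-1 * (1 - q)^-1)) => [a u v|x].
    by rewrite linearP scalerDr !scalerA mulrC.
  by rewrite rnormZr ger0_norm ?invr_ge0 ?(ltW s0) // -mulrA ler_pM2l ?invr_gt0.
have sP : selfadjoint P.
  by move=> x y; rewrite !PE hdotZl hdotZr hdotBl hdotBr sY.
have sinv : (s^-1)%:C * s%:C = 1 :> R[i].
  by rewrite -rmorphM mulVf ?gt_eqF.
exists P, Q; split=> //.
- split=> x; rewrite PE QE.
    by rewrite linearZ_LR /= Z2 scalerA sinv scale1r.
  by rewrite linearZ_LR /= -scalerBr Z1 scalerA mulrC sinv scale1r.
- move=> x; apply: selfadjoint_ge0 => //; rewrite PE hdotZl hdotBl hdotxx.
  rewrite Re_realM mulr_ge0 ?(ltW s0) // Re_B /= subr_ge0.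
  have := Re_hdot_CS (Y x) x => h; rewrite (le_trans (ler_norm _)) //.
  rewrite (le_trans h) // expr2 ler_wpM2r ?rnorm_ge0 // (le_trans (bY _)) //.
  by rewrite ler_piMl ?rnorm_ge0 // ltW.
- move=> x; rewrite !PE.
  have -> : Y (s%:C *: (x - Y x)) = s%:C *: (Y x - Y (Y x)) by rewrite linearZ_LR linearB.
  rewrite -scalerBr scalerA -rmorphM ss.
  have -> : x - Y x - (Y x - Y (Y x)) = x - C x.
    by rewrite opprB [Y (Y x) - _]addrC addrA -(addrA x) -opprD YE opprD addrA subrK.
  by rewrite CE subKr scalerA -rmorphM divff ?gt_eqF // scale1r.
Qed.
End SquareRoot.

(** * The invariant inner product *)

Section InvariantForm.
Variables (R : realType) (H : hilbertSpace R).
Local Notation "''[' u , v ]" := (hdot H u v) : ring_scope.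
Implicit Types (x y z : H).

Lemma iter_linearP (S : {linear H -> H}) n (a : R[i]) x y :
  iter n S (a *: x + y) = a *: iter n S x + iter n S y.
Proof. by elim: n => //= n ->; rewrite linearP. Qed.

(** The form (x, y) |-> LIM <S^n x, S^n y>, for a Banach limit LIM, is
    an inner product preserved by S, because applying S to both arguments shifts
    the sequence. The two bounds on the powers of S make it equivalent to the
    original inner product, and Riesz representation turns it into <x, B y>. *)
Lemma invariant_form (S : bop H) (c M : R) : 0 <= c -> 0 <= M ->
  (forall n, bounded_by M (iter n S)) ->
  (forall n x, c * rnorm x <= rnorm (iter n S x)) ->
  exists B : bop H, [/\ selfadjoint B,
    forall x, c ^+ 2 * rnorm x ^+ 2 <= complex.Re '[B x, x] <= M ^+ 2 * rnorm x ^+ 2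
    & forall x y, '[S x, B (S y)] = '[x, B y]].
Proof.
move=> c0 M0 bS cS; have [L [LD LZ Lle Lshift]] := banach_limit_exists R.
have LN u : bounded_seq u -> L (fun n => - u n) = - L u.
  move=> bu; rewrite -mulN1r -LZ //; congr L; apply/funext => n; exact: (esym (mulN1r _)).
have Lnorm u K : (forall n, `|u n| <= K) -> `|L u| <= K.
  move=> uK; have bu : bounded_seq u by exists K.
  rewrite ler_norml lerNl -LN // !Lle // => [n||n].
  - by have := uK n; rewrite ler_norml => /andP[].
  - by exists K => n; rewrite normrN.
  - by have := uK n; rewrite ler_norml lerNl => /andP[].
pose d x y n := '[iter n S x, iter n S y].
have dle x y n : rnorm (iter n S x) * rnorm (iter n S y) <= M * rnorm x * (M * rnorm y).
  by apply: ler_pM; rewrite ?rnorm_ge0 ?bS.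
have reK x y n : `|complex.Re (d x y n)| <= M * rnorm x * (M * rnorm y).
  exact: le_trans (Re_hdot_CS _ _) (dle _ _ _).
have imK x y n : `|complex.Im (d x y n)| <= M * rnorm x * (M * rnorm y).
  exact: le_trans (Im_hdot_CS _ _) (dle _ _ _).
have bre x y : bounded_seq (fun n => complex.Re (d x y n)) by eexists; exact: reK.
have bim x y : bounded_seq (fun n => complex.Im (d x y n)) by eexists; exact: imK.
have bZ k u : bounded_seq u -> bounded_seq (fun n => k * u n).
  by move=> [K uK]; exists (`|k| * K) => n; rewrite normrM ler_wpM2l.
have bD u v : bounded_seq u -> bounded_seq v -> bounded_seq (u \+ v).
  move=> [K uK] [K' vK]; exists (K + K') => n.
  by rewrite (le_trans (ler_normD _ _)) // lerD.
pose phi y x : R[i]^o := L (fun n => complex.Re (d x y n)) +i* L (fun n => complex.Im (d x y n)).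
have lphi y : linear (phi y).
  move=> a u v; rewrite /phi.
  have dE n : d (a *: u + v) y n = a * d u y n + d v y n.
    by rewrite /d iter_linearP hdotDl hdotZl.
  have -> : (fun n => complex.Re (d (a *: u + v) y n)) =
      (((fun n => complex.Re a * complex.Re (d u y n)) \+
       (fun n => - complex.Im a * complex.Im (d u y n))) \+
       (fun n => complex.Re (d v y n))).
    apply/funext => n; rewrite dE /=; case: a {dE} (d u y n) (d v y n) => [p q] [p' q'] [r s] /=.
    by rewrite mulNr.
  have -> : (fun n => complex.Im (d (a *: u + v) y n)) =
      (((fun n => complex.Re a * complex.Im (d u y n)) \+
       (fun n => complex.Im a * complex.Re (d u y n))) \+
       (fun n => complex.Im (d v y n))).
    by apply/funext => n; rewrite dE /=; case: a {dE} (d u y n) (d v y n) => [p q] [p' q'] [r s] /=.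
  rewrite !LD ?LZ; try by repeat first [apply: bD|apply: bZ|exact: bre|exact: bim].
  set p := L _; set q := L _; set r := L _; set s := L _.
  by case: a {dE} => a1 a2; apply/eqP; rewrite eq_complex /= mulNr !eqxx.
have bphi y x : `|phi y x| <= (2 * M * M * rnorm y)%:C * `|x|.
  have -> : phi y x = (complex.Re (phi y x))%:C + 'i * (complex.Im (phi y x))%:C.
    exact: complexE.
  apply: le_trans (ler_normD _ _) _.
  rewrite normrM [`|'i|]normc_def /= expr0n expr1n add0r sqrtr1 mul1r.
  rewrite [`|(L _)%:C|]normc_def [X in _ + X]normc_def /= expr0n !addr0 !sqrtr_sqr.
  rewrite normE -rmorphM -rmorphD lecR.
  have h1 := Lnorm _ _ (reK x y); have h2 := Lnorm _ _ (imK x y); lra.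
have /choice[B BP] : forall y, exists z, forall x, phi y x = '[x, z].
  move=> y.
  pose f : {linear H -> R[i]^o} := HB.pack (phi y) (GRing.isLinear.Build _ _ _ _ _ (lphi y)).
  apply: (@riesz _ _ f); apply/linear_continuousP.
  exists (1 + 2 * M * M * rnorm y)%:C.
    by rewrite ltcR ltr_pwDl // !mulr_ge0 ?rnorm_ge0.
  move=> x; apply: le_trans (bphi y x) _.
  by rewrite ler_wpM2r // lecR lerDr.
have phiC x y : phi y x = Num.conj (phi x y).
  rewrite /phi; apply/eqP; rewrite eq_complex /= -LN //.
  by apply/andP; split; apply/eqP; congr L; apply/funext => n; rewrite /d; [exact: hdot_re|exact: hdot_im].
have sB : selfadjoint B.
  by move=> x y; rewrite hdotC -!BP -phiC.
have reB x y : complex.Re '[x, B y] = L (fun n => complex.Re (d x y n)) by rewrite -BP.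
have lB : linear B.
  move=> a u v; apply: hdot_inj => z.
  by rewrite -sB !hdotDr -sB; congr (_ + _); rewrite !linearZr_LR /= sB.
have bB : bounded_by (M * M) B.
  move=> x; have [->|Bx0] := eqVneq (rnorm (B x)) 0.
    by rewrite !mulr_ge0 ?rnorm_ge0.
  rewrite -(@ler_pM2l _ (rnorm (B x))); last by rewrite lt_neqAle eq_sym Bx0 rnorm_ge0.
  rewrite -expr2 -Re_hdotxx reB (le_trans (ler_norm _)) //.
  by rewrite (le_trans (Lnorm _ _ (reK _ _))) //; lra.
have [Bb BbE] := bop_of lB bB.
exists Bb; split=> [x y|x|x y].
- by rewrite !BbE.
- rewrite BbE hdot_re reB.
  have dxx n : complex.Re (d x x n) = rnorm (iter n S x) ^+ 2 by rewrite /d hdotxx.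
  rewrite -!exprMn; apply/andP; split; last first.
    apply: Lle => // n; rewrite dxx ler_pXn2r ?nnegrE ?mulr_ge0 ?rnorm_ge0 //.
    exact: bS.
  rewrite -lerN2 -LN //; apply: Lle => [|n].
    by have [K uK] := bre x x; exists K => n; rewrite normrN.
  by rewrite lerN2 dxx ler_pXn2r ?nnegrE ?mulr_ge0 ?rnorm_ge0.
- rewrite !BbE -!BP /phi.
  have dS n : d (S x) (S y) n = d x y n.+1 by rewrite /d -!iterSr.
  rewrite -[in RHS](Lshift _ (bre x y)) -[in RHS](Lshift _ (bim x y)).
  by congr (L _ +i* L _); apply/funext => n; rewrite dS.
Qed.
End InvariantForm.

(** * Power boundedness and finite differences *)

Section PowerBounded.
Variables (R : realType) (H : hilbertSpace R).
Local Notation "''[' u , v ]" := (hdot H u v) : ring_scope.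
Implicit Types (x y z : H).

(** The suprema in [power_bounded] range over the unit ball; homogeneity
    extends the bound to all vectors. *)
Lemma power_boundedP (f : H -> H) : (forall (a : R[i]) x, f (a *: x) = a *: f x) ->
  power_bounded f <-> exists2 M, 0 < M & forall n, bounded_by M (iter n f).
Proof.
move=> fZ; have iZ n (a : R[i]) x : iter n f (a *: x) = a *: iter n f x.
  by elim: n => //= n ->.
split=> [[M M0 fM]|[M M0 fM]]; last first.
  exists (M + 1); first by rewrite addr_gt0.
  apply: (@le_lt_trans _ _ M%:E); last by rewrite lte_fin ltrDl.
  apply: ge_ereal_sup => _ [n _ <-]; apply: ge_ereal_sup => _ [x /= x1 <-].
  rewrite lee_fin (le_trans (fM n x)) // ler_piMr ?(ltW M0) //.
  by rewrite rnorm_le.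
exists M => // n x; have [->|x0] := eqVneq x 0.
  by rewrite -(scale0r 0) iZ !scale0r rnorm0 mulr0.
have r0 : 0 < rnorm x.
  by rewrite lt_neqAle rnorm_ge0 andbT eq_sym; apply: contra x0 => /eqP/rnorm_eq0 ->.
have : ((rnorm (iter n f ((rnorm x)^-1%:C *: x)))%:E < M%:E)%E.
  apply: le_lt_trans fM; apply: (@le_trans _ _ (opnorm (iter n f))); last first.
    by apply: ereal_sup_ubound; exists n.
  apply: ereal_sup_ubound; exists ((rnorm x)^-1%:C *: x) => //=.
  by rewrite -rnorm_le rnormZr ger0_norm ?invr_ge0 ?rnorm_ge0 // mulVf ?gt_eqF.
rewrite lte_fin iZ rnormZr ger0_norm ?invr_ge0 ?rnorm_ge0 // => /ltW.
by rewrite ler_pdivrMl // mulrC.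
Qed.

(** The m-th forward difference of a at k in its expanded form, which is the
    one that occurs in the definition of a left m-inverse. *)
Definition diffn m (a : nat -> H) k : H :=
  \sum_(j < m.+1) ((-1) ^+ (m - j) * 'C(m, j)%:R : R[i]) *: a (k + j)%N.

Lemma diffnS m a k : diffn m.+1 a k = diffn m (fun i => a i.+1 - a i) k.
Proof.
rewrite /diffn.
under [RHS]eq_bigr do rewrite scalerBr.
rewrite sumrB big_ord_recl subn0 bin0 mulr1 addn0.
rewrite [in X in _ - X]big_ord_recl /= subn0 bin0 mulr1 addn0.
under eq_bigr => j _.
  rewrite /bump leq0n add1n binS subSS natrD mulrDr scalerDl addnS.
over.
rewrite big_split /= addrA addrC; congr (_ + _).
rewrite big_ord_recr /= bin_small // mulr0 scale0r addr0.
rewrite opprD -scaleNr exprS mulN1r; congr (_ + _).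
rewrite -sumrN; apply: eq_bigr => j _.
rewrite -scaleNr -mulNr /bump leq0n add1n addnS; congr ((_ * _) *: _).
by rewrite -[in LHS](subnSK (ltn_ord j)) exprS mulN1r.
Qed.

(** A sequence with vanishing differences of order m + 1 is polynomial of
    degree at most m, and a bounded polynomial is constant. By induction the
    increments are constant, so the sequence is affine, and boundedness kills
    the slope. *)
Lemma bounded_diffn0 m (a : nat -> H) (K : R) : (forall n, rnorm (a n) <= K) ->
  (forall k, diffn m.+1 a k = 0) -> forall n, a n = a 0%N.
Proof.
elim: m a K => [|m IH] a K aK ha.
  elim=> // n <-; have := ha n; rewrite diffnS /diffn big_ord1 expr0 mul1r scale1r addn0.
  by move/eqP; rewrite subr_eq0 => /eqP.
pose b n := a n.+1 - a n.
have bK n : rnorm (b n) <= K + K by rewrite (le_trans (rnormB _ _)) // lerD.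
have hb k : diffn m.+1 b k = 0 by rewrite -diffnS.
have bc := IH _ _ bK hb.
have aE n : a n = a 0%N + b 0%N *+ n.
  elim: n => [|n IHn]; first by rewrite mulr0n addr0.
  by rewrite mulrS [b 0%N + _]addrC addrA -IHn -(bc n) addrC subrK.
suff b0 : b 0%N = 0 by move=> n; rewrite aE b0 mul0rn addr0.
apply: rnorm_eq0; apply/eqP; rewrite eq_le rnorm_ge0 andbT leNgt; apply/negP => b0.
have [n nK] : exists n, (K + K) / rnorm (b 0%N) < n%:R.
  exists (Num.bound ((K + K) / rnorm (b 0%N))); apply: archi_boundP.
  by rewrite divr_ge0 ?rnorm_ge0 // (le_trans (rnorm_ge0 (b 0%N))).
have : rnorm (a n - a 0%N) <= K + K by rewrite (le_trans (rnormB _ _)) // lerD.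
rewrite aE addrC addKr -scaler_nat -[n%:R](rmorph_nat (real_complex R)) rnormZr.
by rewrite ger0_norm // leNgt -ltr_pdivrMr // nK.
Qed.

(** The sequence T^n (S^n x) is bounded, and its m-th difference at k is T^k
    applied to the defining sum of an m-inverse at S^k x; so it is constant. *)
Lemma powers_bounded_left_inverse m (T S : bop H) (M N : R) : (0 < m)%N -> left_minverse m T S ->
  (forall n, bounded_by M (iter n T)) -> (forall n, bounded_by N (iter n S)) ->
  0 <= M ->
  forall n x, iter n T (iter n S x) = x.
Proof.
case: m => // m _ TS bT bS M0 n x.
apply: (@bounded_diffn0 m (fun n => iter n T (iter n S x)) (M * (N * rnorm x))).
  by move=> k; rewrite (le_trans (bT _ _)) // ler_wpM2l //; exact: bS.
move=> k; have := congr1 (iter k T) (TS (iter k S x)).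
have itB u v : iter k T (u + v) = iter k T u + iter k T v.
  by have := iter_linearP T k 1 u v; rewrite !scale1r.
have it0 : iter k T 0 = 0 by apply: (addrI (iter k T 0)); rewrite -itB !addr0.
rewrite it0 (big_morph _ itB it0) => h; rewrite -[RHS]h; apply: eq_bigr => j _.
rewrite -[X in iter k T X]addr0 iter_linearP it0 addr0.
by rewrite iterD addnC iterD.
Qed.

End PowerBounded.

(** * The single-valued extension property and kernels *)

Section SVEP.
Variables (R : realType) (H : hilbertSpace R).
Local Notation "''[' u , v ]" := (hdot H u v) : ring_scope.
Implicit Types (x y z : H).

(** If K bounds L and |l| < 1 / (2 K), then l L is a contraction with factor 1/2,
    so 1 - l L has an inverse bounded by 2, uniformly in l. *)
Lemma resolvent_exists (L : bop H) : exists2 r : R, 0 < r &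
  exists Z : R[i] -> bop H, forall l, `|l| < r%:C ->
    [/\ forall x, Z l x - l *: L (Z l x) = x,
        forall x, Z l (x - l *: L x) = x & bounded_by 2 (Z l)].
Proof.
have [K K0 bL] := bop_bounded L; exists (2 * K)^-1.
  by rewrite invr_gt0 mulr_gt0.
suff h l : exists Z : bop H, `|l| < (2 * K)^-1%:C ->
    [/\ forall x, Z x - l *: L (Z x) = x,
        forall x, Z (x - l *: L x) = x & bounded_by 2 Z].
  by have /choice[Z ZP] := h; exists Z.
have [lr|lr] := pselect (`|l| < (2 * K)^-1%:C); last by exists L => /lr.
have lr' : complex.Re `|l| < (2 * K)^-1 by rewrite -ltcR RRe_real ?normr_real.
have bY : bounded_by 2^-1 (fun x => l *: L x).
  move=> x; rewrite rnormZ.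
  have -> : 2^-1 * rnorm x = (2 * K)^-1 * (K * rnorm x).
    by field; rewrite gt_eqF.
  apply: ler_pM; rewrite ?rnorm_ge0 ?(ltW lr') //.
  by rewrite -ler0c RRe_real ?normr_real ?normr_ge0.
have lY : linear (fun x => l *: L x).
  by move=> a u v; rewrite linearP scalerDr !scalerA mulrC.
have [Y YE] := bop_of lY bY.
have bY' : bounded_by 2^-1 Y by move=> x; rewrite YE.
have [|Z [Z1 Z2 bZ]] := @neumann _ _ 2^-1 Y _ bY'; first by lra.
exists Z => _; split=> x; rewrite -?YE //.
by have := bZ x; have -> : (1 - 2^-1)^-1 = 2 :> R by field.
Qed.

(** If A e = 0 and L is a right inverse of A, then f(l) = (1 - l L)^-1 e
    satisfies f(l) - l L f(l) = e; applying A gives A f(l) = l f(l). The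
    function f is analytic near 0 with f(0) = e, so SVEP at 0 forces e = 0. *)
Lemma svep_kernel (A L : bop H) : (forall x, A (L x) = x) -> has_SVEP_at A 0 ->
  forall e, A e = 0 -> e = 0.
Proof.
move=> AL svep e Ae; have [r r0 [Z ZP]] := resolvent_exists L.
have [K K0 bL] := bop_bounded L.
pose f : R[i]^o -> H := fun l => Z l e.
have f0 : f 0 = e.
  have [] := ZP 0; first by rewrite normr0 ltcR.
  by move=> /(_ e) + _ _; rewrite scale0r subr0.
rewrite -f0; apply: (svep r f r0).
- move=> l; rewrite -ball_normE /= sub0r normrN => lr.
  have [Zl1 Zl2 bZl] := ZP _ lr.
  have res h v : `|l + h| < r%:C -> Z (l + h) v - Z l v = h *: Z (l + h) (L (Z l v)).
    move=> hr; have [Zh1 Zh2 bZh] := ZP _ hr.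
    set w := Z l v.
    have -> : v = h *: L w + (w - (l + h) *: L w).
      by rewrite -[LHS]Zl1 -/w [RHS]addrC scalerDl opprD addrA subrK.
    by rewrite linearP Zh2 addrK.
  apply/cvg_ex; exists (Z l (L (f l))).
  apply/cvgrPdist_lt => eps eps0.
  have epsE : eps = (complex.Re eps)%:C by rewrite RRe_real // gtr0_real.
  have e0 : 0 < complex.Re eps by rewrite -ltcR -epsE.
  set C := 2 * rnorm (L (Z l (L (f l)))) + 1.
  have C0 : 0 < C by rewrite ltr_wpDl // mulr_ge0 // rnorm_ge0.
  have lr0 : 0 < r%:C - `|l| by rewrite subr_gt0.
  have dl0 : 0 < (complex.Re eps / C)%:C by rewrite ltcR divr_gt0.
  (* By the resolvent identity the error of the difference quotient is
     h Z(l + h) L Z(l) L (f l), of norm at most |h| C. *)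
  near=> h.
  have hn : h != 0 by near: h; exact: nbhs_dnbhs_neq.
  have h1 : `|h| < r%:C - `|l| by near: h; exact: dnbhs0_lt.
  have h2 : `|h| < (complex.Re eps / C)%:C by near: h; exact: dnbhs0_lt.
  have lh : `|l + h| < r%:C.
    by rewrite (le_lt_trans (ler_normD _ _)) // addrC -ltrBrDr.
  rewrite /= /shift /= [h *: 1]mulr1 [h + l]addrC /f (res h e lh) scalerA mulVf // scale1r.
  rewrite -normrN opprB (res h _ lh) epsE normE ltcR rnormZ.
  have [_ _ bZh] := ZP _ lh.
  have h2' : complex.Re `|h| < complex.Re eps / C by rewrite -ltcR RRe_real ?normr_real.
  have h0 : 0 <= complex.Re `|h| by rewrite -ler0c RRe_real ?normr_real ?normr_ge0.
  apply: (@le_lt_trans _ _ (complex.Re `|h| * C)); last by rewrite -ltr_pdivlMr.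
  by rewrite ler_wpM2l // (le_trans (bZh _)) // lerDl.
- move=> l; rewrite -ball_normE /= sub0r normrN => lr; have [Zl1 _ _] := ZP _ lr.
  have := congr1 A (Zl1 e); rewrite linearB linearZ_LR AL Ae; exact.
- by apply: ballxx; rewrite ltcR.
Unshelve. all: by end_near. Qed.
End SVEP.

Section Kernel.
Variables (R : realType) (H : hilbertSpace R).
Local Notation "''[' u , v ]" := (hdot H u v) : ring_scope.
Implicit Types (x y z : H).

Lemma dense_kernel (S : bop H) : dense (range S) ->
  forall e, adjoint S e = 0 -> e = 0.
Proof.
move=> dS e Se; apply: rnorm_eq0; apply/eqP; rewrite eq_le rnorm_ge0 andbT leNgt.
apply/negP => e0.
have [y [+ +]] : ball e (rnorm e)%:C `&` range S !=set0.
  apply: dS; last exact: ball_open.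
  by exists e; apply: ballxx; rewrite ltcR.
rewrite -ball_normE /= normE ltcR => h [x _ xy].
have o : '[e, y] = 0.
  by rewrite hdotC -xy adjointP Se linear0r conjC0.
have := Re_hdot_CS e (e - y); rewrite hdotBr o subr0 Re_hdotxx ger0_norm ?sqr_ge0 //.
by rewrite expr2 ler_pM2l // leNgt h.
Qed.

End Kernel.

(** * Power boundedness under similarity and adjunction *)

Section Similarity.
Variables (R : realType) (H : hilbertSpace R).
Local Notation "''[' u , v ]" := (hdot H u v) : ring_scope.
Implicit Types (x y z : H).

Definition powers_bounded (f : H -> H) := exists2 M, 0 < M & forall n, bounded_by M (iter n f).

Lemma bop_power_boundedP (S : bop H) : power_bounded S <-> powers_bounded S.
Proof. by apply: power_boundedP => a x; rewrite linearZ_LR. Qed.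

Lemma similar_powers_bounded (X Y : bop H) (f g : H -> H) :
  mutually_inverse X Y -> (forall x, f x = X (g (Y x))) ->
  powers_bounded g -> powers_bounded f.
Proof.
move=> [XY YX] fE [M M0 bg]; have [K K0 bX] := bop_bounded X.
have [N N0 bY] := bop_bounded Y.
exists (K * (M * N)); first by rewrite !mulr_gt0.
move=> n; have -> : iter n f = X \o (iter n g \o Y).
  by apply/funext => x; elim: n => [|n IH] /=; rewrite ?YX // IH fE /= XY.
apply: bounded_by_comp; [exact: ltW|exact: bX|].
by apply: bounded_by_comp; [exact: ltW|exact: bg|exact: bY].
Qed.

Lemma adjoint_iter (S : bop H) n x y : '[iter n S x, y] = '[x, iter n (adjoint S) y].
Proof. by elim: n y => //= n IH y; rewrite adjointP IH -iterSr. Qed.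

Lemma adjoint_powers_bounded (S : bop H) :
  powers_bounded (adjoint S) <-> powers_bounded S.
Proof.
split=> -[M M0 bS]; exists M => // n.
  apply: bounded_by_adj (bS n) => x y; rewrite hdotC -adjoint_iter -hdotC //.
by apply: bounded_by_adj (bS n) => x y; exact: adjoint_iter.
Qed.

Lemma iter_cancel (f g : H -> H) n : cancel f g -> cancel (iter n f) (iter n g).
Proof. by move=> fg; elim: n => // n IH x; rewrite iterSr iterS fg IH. Qed.

(** All the terms T^j S^j are the identity, and the alternating sum of
    the binomial coefficients is (-1 + 1)^m = 0. *)
Lemma left_inverse_minverse m (f g : H -> H) : (0 < m)%N -> cancel f g ->
  left_minverse m g f.
Proof.
move=> m0 fg x.
under eq_bigr do rewrite (iter_cancel _ fg).
rewrite -scaler_suml.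
have -> : \sum_(j < m.+1) (-1) ^+ (m - j) * 'C(m, j)%:R = (-1 + 1) ^+ m :> R[i].
  by rewrite exprDn; apply: eq_bigr => j _; rewrite expr1n mulr1 mulr_natr.
by rewrite addNr expr0n gtn_eqF // scale0r.
Qed.

(** The square root P of the operator of the invariant inner product satisfies
    |P S x| = |P x|. The lower bound on |S^n x| needed there comes from
    x = T^n (S^n x) and the bound on the powers of T. *)
Lemma invariant_sqrt (S T : bop H) : powers_bounded S -> powers_bounded T ->
  cancel S T -> exists P Pinv : bop H,
  [/\ mutually_inverse P Pinv, positive_op P, selfadjoint P
    & forall x y, '[P (S x), P (S y)] = '[P x, P y]].
Proof.
move=> [M M0 bS] [N N0 bT] ST.
have cS n x : N^-1 * rnorm x <= rnorm (iter n S x).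
  by rewrite ler_pdivrMl // -{1}(iter_cancel n ST x); exact: bT.
have c0 : 0 < N^-1 by rewrite invr_gt0.
have [B [sB hB SB]] := invariant_form (ltW c0) (ltW M0) bS cS.
have [||P [Pinv [Pi Pp sP PB]]] := @positive_sqrt _ _ B (N^-1 ^+ 2) (N^-1 ^+ 2 + M ^+ 2) _ sB.
- by rewrite exprn_gt0 // ltrDl exprn_gt0.
- move=> x; have /andP[-> h] := hB x; rewrite /= mulrDl (le_trans h) // lerDr.
  by rewrite mulr_ge0 // sqr_ge0.
exists P, Pinv; split=> // x y.
by rewrite !sP !PB SB.
Qed.

End Similarity.

Theorem theorem2p4 (R : realType) (H : hilbertSpace R)
    (Hinf : infinite_dimensional H) (m : nat) (m_ge1 : (1 <= m)%N)
    (S T : bop H) (T_pb : power_bounded T) (ST : left_minverse m T S) :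
  let i := power_bounded S in
  let ii := exists P Pinv V : bop H,
    [/\ mutually_inverse P Pinv, positive_op P, isometric_op V
      & S =1 Pinv \o V \o P] in
  let iii := exists A Ainv : bop H,
    [/\ mutually_inverse A Ainv, positive_op A,
        power_bounded (Ainv \o adjoint S \o A)
      & left_minverse m (Ainv \o adjoint S \o A) S] in
  [/\ i <-> ii, ii <-> iii, i <-> iii
    & [\/ i, ii | iii] ->
      has_SVEP_at (adjoint S) 0 \/ dense (range S) ->
      exists U1 U2 : bop H,
        [/\ unitary_op U1, unitary_op U2, similar_ops S U1,
            similar_ops (adjoint T) U2
          & similar_ops U1 U2]].
Proof.
move=> i ii iii.
have ii_i : ii -> i.
  move=> [P [Q [V [[PQ QP] _ Viso SE]]]]; apply/bop_power_boundedP.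
  apply: (@similar_powers_bounded _ _ Q P S V) => //.
  exists 1 => // n x; rewrite mul1r rnorm_le -normE.
  by elim: n => //= n IH; rewrite Viso.
have iii_i : iii -> i.
  move=> [A [Ainv [[AQ QA] _ pb _]]]; apply/bop_power_boundedP/adjoint_powers_bounded.
  apply: (@similar_powers_bounded _ _ A Ainv _ (Ainv \o adjoint S \o A)) => //.
    by move=> x /=; rewrite !QA.
  by apply/power_boundedP => // a x /=; rewrite !linearZ_LR.
have TS : i -> cancel S T.
  move=> /bop_power_boundedP[M M0 bS] x.
  have /bop_power_boundedP[N N0 bT] := T_pb.
  exact: (powers_bounded_left_inverse m_ge1 ST bT bS (ltW N0) 1%N x).
have sqrtP : i -> exists P Q : bop H, [/\ mutually_inverse P Q, positive_op P,
    selfadjoint P & forall x y, hdot H (P (S x)) (P (S y)) = hdot H (P x) (P y)].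
  move=> hi; apply: (@invariant_sqrt _ _ S T); [exact/bop_power_boundedP|exact/bop_power_boundedP|exact: TS].
have isoP (P Q : bop H) : cancel Q P -> 
    (forall x y, hdot H (P (S x)) (P (S y)) = hdot H (P x) (P y)) ->
    forall x y, hdot H (P (S (Q x))) (P (S (Q y))) = hdot H x y.
  by move=> QP h x y; rewrite h !QP.
have i_ii : i -> ii.
  move=> hi; have [P [Q [[PQ QP] Pp sP SP]]] := sqrtP hi.
  exists P, Q, (bcomp P (bcomp S Q)); split=> // [x|x] /=; last by rewrite PQ PQ.
  apply/eqP; rewrite -(@eqrXn2 _ 2) // -!hdot_norm; apply/eqP.
  exact: isoP.
have SAS (P : bop H) : selfadjoint P -> 
    (forall x y, hdot H (P (S x)) (P (S y)) = hdot H (P x) (P y)) ->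
    forall x, adjoint S (P (P (S x))) = P (P x).
  by move=> sP SP x; apply: hdot_inj => z; rewrite -adjointP -sP SP sP.
have i_iii : i -> iii.
  move=> hi; have [P [Q [[PQ QP] Pp sP SP]]] := sqrtP hi.
  have inv : mutually_inverse (bcomp P P) (bcomp Q Q).
    by split=> x /=; rewrite ?PQ ?QP ?PQ ?QP.
  exists (bcomp P P), (bcomp Q Q); split => //.
  - by move=> x /=; rewrite sP hdotxx ler0c sqr_ge0.
  - apply/power_boundedP => [a x /=|]; first by rewrite !linearZ_LR.
    apply: (@similar_powers_bounded _ _ (bcomp Q Q) (bcomp P P) _ (adjoint S)) => //.
      by case: inv.
    by apply/adjoint_powers_bounded/bop_power_boundedP.
  - by apply: left_inverse_minverse => // x /=; rewrite SAS // !PQ.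
have iE : [\/ i, ii | iii] -> i by case.
split; [by split|by split=> [/ii_i/i_iii|/iii_i/i_ii]|by split|].
move=> /iE hi hyp; have [P [Q [[PQ QP] Pp sP SP]]] := sqrtP hi.
have {}SAS := SAS P sP SP; have {}TS := TS hi; have {}isoP := isoP P Q QP SP.
have kerS e : adjoint S e = 0 -> e = 0.
  case: hyp => [svep|]; last by move=> /dense_kernel; exact.
  apply: (svep_kernel (L := adjoint T)) svep _ => x.
  by apply: hdot_inj => z; rewrite -!adjointP TS.
pose W := bcomp (bcomp Q Q) (bcomp (adjoint S) (bcomp P P)).
have WS x : W (S x) = x by rewrite /= SAS !PQ.
(* W is B^-1 (adjoint S) B with B = P^2, and S W is a projection onto the range of S. *)
have SW y : S (W y) = y.
  have : P (P (y - S (W y))) = 0.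
    by apply: kerS; rewrite !linearB /= SAS !QP subrr.
  by move=> /(congr1 (Q \o Q)) /=; rewrite !PQ !linear0 => /subr0_eq.
have TW y : T y = W y by rewrite -{1}(SW y) TS.
pose U := bcomp P (bcomp S Q).
have U1 : cancel U (adjoint U).
  by move=> x; apply: hdot_inj => z; rewrite -adjointP; exact: isoP.
have UW y : U (P (W (Q y))) = y by rewrite [LHS]/= PQ SW QP.
have U2 : cancel (adjoint U) U by move=> y; rewrite -{1}(UW y) U1 UW.
exists U, U; split=> //.
- by exists Q, P; split=> // x /=; rewrite !PQ.
- exists P, Q; split=> // y; apply: hdot_inj => z; rewrite -adjointP [RHS]/= -sP.
  rewrite TW -[in RHS](UW (P z)) PQ isoP. 
  by rewrite sP QP.
- by exists U, (adjoint U); split=> // x; rewrite /comp U2.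
Qed.
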